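(* Let $\mathrm{Re}(\ell)\ge0$. For all $m,n\in\mathbb{N}_0$ with $m\le n$, $$\left([n-m+1]_{\ell}\right)_m=\frac{(n!)^{\ell n+1}}{((n-m)!)^{\ell n-\ell m+1}}.$$
   Context: $\mathbb{N}_0$ is the set of non-negative integers. For $n\in\mathbb{N}$ and $\ell\in\mathbb{C}$ with $\mathrm{Re}(\ell)\ge0$, the $\ell$-analogue of $n$ is $[n]_{\ell}=n^{\ell n+1}((n-1)!)^{\ell}=\dfrac{(n!)^{\ell n+1}}{((n-1)!)^{\ell n-\ell+1}}$, and $[0]_\ell=0$. The $\ell$-H Pochhammer symbol is $\left([n]_{\ell}\right)_k=[n]_{\ell}[n+1]_{\ell}\cdots[n+k-1]_{\ell}$ (a product of $k$ factors, equal to $1$ when $k=0$). *)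

(* Defs.v *)
From HB Require Import structures.
From mathcomp Require Import all_boot all_order all_algebra.
From mathcomp Require Import all_classical all_reals all_analysis.
From mathcomp Require Import complex.

Set Implicit Arguments.
Unset Strict Implicit.
Unset Printing Implicit Defensive.

Import Order.TTheory GRing.Theory Num.Theory.
Local Open Scope ring_scope.
Local Open Scope complex_scope.

Definition cexp (R : realType) (z : R[i]) : R[i] :=
  (expR (complex.Re z))%:C * (cos (complex.Im z) +i* sin (complex.Im z)).

(* Principal value of x ^ z for a positive real base x. For x <= 0, where
   ln x = 0, the value is a meaningless 1; the definitions below only use
   positive integers as bases. *)
Definition cpow (R : realType) (x : R) (z : R[i]) : R[i] :=
  cexp (z * (ln x)%:C).

(* The l-analogue [n]_l of n; it is meant for 0 <= Re l. *)
Definition lnum (R : realType) (l : R[i]) (n : nat) : R[i] :=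
  if n == 0%N then 0
  else cpow n%:R (l * n%:R + 1) * cpow (n.-1)`!%:R l.

(* The l-H Pochhammer symbol ([n]_l)_k. It depends on n, not only on the
   complex number [n]_l. *)
Definition lpoch (R : realType) (l : R[i]) (n k : nat) : R[i] :=
  \prod_(0 <= j < k) lnum l (n + j).

(* Main.v *)
Require Import Defs.
From mathcomp Require Import all_boot all_order all_algebra.
From mathcomp Require Import all_classical all_reals all_analysis.
From mathcomp Require Import complex.
From mathcomp Require Import ring.

Import Order.TTheory GRing.Theory Num.Theory.
Local Open Scope ring_scope.
Local Open Scope complex_scope.

(** Writing [f k] for [(k!)^(l k + 1)], the definition of [[k + 1]_l] gives
    [[k + 1]_l * f k = f (k + 1)]; the product defining the Pochhammer symbol
    therefore telescopes to [f n / f (n - m)]. *)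

Lemma cexpD (R : realType) (z w : R[i]) : cexp (z + w) = cexp z * cexp w.
Proof.
case: z w => [a b] [c d]; rewrite /cexp /= expRD cosD sinD.
by apply/eqP; rewrite eq_complex /=; apply/andP; split; apply/eqP; ring.
Qed.

Lemma cexp0 (R : realType) : cexp (0 : R[i]) = 1.
Proof. by rewrite /cexp /= expR0 cos0 sin0 mul1r. Qed.

(** By the addition law, [cexp (- z)] is an inverse of [cexp z]. *)
Lemma cexp_neq0 (R : realType) (z : R[i]) : cexp z != 0.
Proof.
apply/eqP => z0; have := cexpD _ z (- z).
by rewrite subrr cexp0 z0 mul0r => /eqP; rewrite oner_eq0.
Qed.

Lemma cpowD (R : realType) (x : R) (z w : R[i]) :
  cpow x (z + w) = cpow x z * cpow x w.
Proof. by rewrite /cpow mulrDl cexpD. Qed.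

Lemma cpowM (R : realType) (x y : R) (z : R[i]) : 0 < x -> 0 < y ->
  cpow (x * y) z = cpow x z * cpow y z.
Proof.
by move=> x0 y0; rewrite /cpow lnM ?posrE// rmorphD mulrDr cexpD.
Qed.

(** The two powers of [k!] combine to the exponent [l + (l k + 1) = l (k + 1) + 1], which is also
    that of the base [k + 1], so the bases merge into [(k + 1)!]. *)
Lemma lnumS_fact (R : realType) (l : R[i]) (k : nat) :
  lnum l k.+1 * cpow k`!%:R (l * k%:R + 1) =
  cpow k.+1`!%:R (l * k.+1%:R + 1).
Proof.
rewrite /lnum /= -mulrA -cpowD factS natrM cpowM ?ltr0n ?fact_gt0//.
by congr (_ * cpow _ _); rewrite -natr1 mulrDr mulr1 addrCA addrA.
Qed.

(** With [q] for [n - m] and the denominator cleared, induction on [m] meets neither truncated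
    subtraction nor division. *)
Lemma lpoch_fact (R : realType) (l : R[i]) (q m : nat) :
  lpoch l (q + 1) m * cpow q`!%:R (l * q%:R + 1) =
  cpow (q + m)`!%:R (l * (q + m)%:R + 1).
Proof.
elim: m => [|m IHm]; first by rewrite /lpoch big_nil mul1r addn0.
(* Splits off the last factor, [lnum l (q + 1 + m)], which takes the factorial power from [q + m] to
   [q + m + 1]. *)
rewrite /lpoch big_nat_recr//= mulrAC -/(lpoch _ _ _) IHm mulrC.
by rewrite addn1 addSn lnumS_fact addnS.
Qed.

Theorem mainTheorem6 (R : realType) (l : R[i]) (hl : 0 <= complex.Re l)
    (m n : nat) (hmn : (m <= n)%N) :
  lpoch l (n - m + 1) m =
  cpow n`!%:R (l * n%:R + 1) / cpow (n - m)`!%:R (l * n%:R - l * m%:R + 1).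
Proof.
(* [m <= n] makes [l n - l m] equal to [l] times the truncated difference [n - m]. *)
rewrite -mulrBr -natrB//; have := lpoch_fact R l (n - m) m.
by rewrite subnK// => <-; rewrite mulfK// cexp_neq0.
Qed.
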